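(* Let $\sigma$ be a surjective endomorphism of $(X,\mathcal B,\mu)$, where $\mu$ is quasi-invariant with respect to $\sigma$, and let $\varphi$ be a positive Markovian function for $(\sigma,\mu)$. Let $\{m_i : i\in\Lambda\}$ be a finite or countable family of measurable complex-valued functions on $X$, and put $T_{m_i}(f)=m_i\sqrt{\varphi}\,(f\circ\sigma)$. Then the operators $\{T_{m_i} : i\in\Lambda\}$ generate a representation of the Cuntz algebra $\mathcal O_{|\Lambda|}$ on $L^2(\mu)$ if and only if both of the following hold: (i) $S_\varphi^*(\sqrt{\varphi}\,\overline{m_j}\,m_i)=\delta_{ij}\mathbf 1$ for all $i,j\in\Lambda$; (ii) $\sum_{i\in\Lambda} m_i\,\mathbb E_\varphi(\overline{m_i}f)=f$ for every $f\in L^2(\mu)$.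
   Context: $(X,\mathcal B)$ is a standard Borel space and $\mu$ is a non-atomic Borel probability measure on it. A surjective endomorphism is a measurable map $\sigma:X\to X$ that is onto; $(\mu\circ\sigma^{-1})(A)=\mu(\sigma^{-1}(A))$, and $\mu$ is quasi-invariant if $\mu(A)=0\Leftrightarrow\mu(\sigma^{-1}(A))=0$ for $A\in\mathcal B$. All equalities of functions are modulo $\mu$-null sets. $L^2(\mu)$ consists of complex-valued functions. A Borel function $\varphi$ is Markovian for $(\sigma,\mu)$ if $\int_X (f\circ\sigma)\varphi\,d\mu=\int_X f\,d\mu$ for all $f\in L^1(\mu)$; positive means $\varphi>0$ a.e. Define $S_\varphi(f)=\sqrt\varphi\,(f\circ\sigma)$, an isometry of $L^2(\mu)$. Its adjoint is $S_\varphi^*(g)=\frac{(g\sqrt\varphi\,d\mu)\circ\sigma^{-1}}{d\mu}$, the Radon–Nikodym derivative with respect to $\mu$ of the complex measure $A\mapsto\int_{\sigma^{-1}(A)}g\sqrt\varphi\,d\mu$; the same formula defines $S_\varphi^*(g)$ for every measurable $g$ with $\sqrt\varphi\,g\in L^1(\mu)$ (a condition stated on $S^*_\varphi(g)$ includes this integrability). Put $\mathbb E_\varphi(g)=S_\varphi S_\varphi^*(g)=\sqrt\varphi\,(S_\varphi^*(g)\circ\sigma)$. $\mathbf 1$ is the constant function $1$. Operators $\{T_i : i\in\Lambda\}$ generate a representation of the Cuntz algebra $\mathcal O_{|\Lambda|}$ on a Hilbert space if they are isometries, the projections $T_iT_i^*$ are mutually orthogonal for different indices, and $\sum_{i\in\Lambda}T_iT_i^*=\mathbb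 I$ (strong convergence if $\Lambda$ is infinite). The sum in (ii) converges in $L^2(\mu)$. *)

(* Defs.v *)
From HB Require Import structures.
From mathcomp Require Import all_boot all_order all_algebra.
From mathcomp Require Import finmap complex.
From mathcomp Require Import all_classical all_reals all_analysis.
From mathcomp.analysis.showcase Require Import summability.

Set Implicit Arguments.
Unset Strict Implicit.
Unset Printing Implicit Defensive.

Import Order.TTheory GRing.Theory Num.Theory.
Import numFieldNormedType.Exports.
Export ComplexField.Normc.

Local Open Scope classical_set_scope.
Local Open Scope ring_scope.
Local Open Scope complex_scope.

(* Isomorphic, as a measurable space, to a Polish space with its Borel sets.
   A Hausdorff complete pseudometric space is a complete metric space. *)
Definition standard_borel (R : realType) d (X : measurableType d) : Prop :=
  exists (P : completePseudoMetricType R) (f : X -> P),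
    [/\ hausdorff_space P,
        exists2 D : set P, countable D & dense D,
        bijective f &
        forall A : set X, measurable A <-> <<s [set U : set P | open U] >> (f @` A)].

Section measure_defs.
Context (R : realType) d (X : measurableType d) (mu : probability X R).

Definition nonatomic : Prop :=
  forall A, measurable A -> (0 < mu A)%E ->
    exists B, [/\ measurable B, B `<=` A, (0 < mu B)%E & (mu B < mu A)%E].

Definition quasi_invariant (sigma : X -> X) : Prop :=
  forall A, measurable A -> mu A = 0%E <-> mu (sigma @^-1` A) = 0%E.

Definition cmeasurable (f : X -> R[i]) : Prop :=
  measurable_fun [set: X] (fun x => complex.Re (f x)) /\
  measurable_fun [set: X] (fun x => complex.Im (f x)).

Definition cintegrable (f : X -> R[i]) : Prop :=
  mu.-integrable [set: X] (fun x => (complex.Re (f x))%:E) /\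
  mu.-integrable [set: X] (fun x => (complex.Im (f x))%:E).

Definition cintegral (f : X -> R[i]) : R[i] :=
  (\int[mu]_x complex.Re (f x)) +i* (\int[mu]_x complex.Im (f x)).

Definition markovian (sigma : X -> X) (phi : X -> R) : Prop :=
  measurable_fun [set: X] phi /\
  forall f : X -> R[i], cintegrable f ->
    cintegrable (fun x => f (sigma x) * (phi x)%:C) /\
    cintegral (fun x => f (sigma x) * (phi x)%:C) = cintegral f.

(* Elements of L^2(mu) are given by representatives X -> R[i]; equalities
   between them are stated mu-almost everywhere. *)
Definition L2norm (f : X -> R[i]) : \bar R :=
  Lnorm mu 2%:E (fun x => (normc (f x))%:E).

Definition L2 (f : X -> R[i]) : Prop := cmeasurable f /\ (L2norm f < +oo)%E.

Definition L2inner (f g : X -> R[i]) : R[i] :=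
  cintegral (fun x => f x * conjc (g x)).

Definition L2_operator (T : (X -> R[i]) -> X -> R[i]) : Prop :=
  [/\ forall f, L2 f -> L2 (T f),
      forall f g, L2 f -> L2 g -> f = g %[ae mu] -> T f = T g %[ae mu] &
      forall (c : R[i]) f g, L2 f -> L2 g ->
        T (fun x => c * f x + g x) = (fun x => c * T f x + T g x) %[ae mu]].

Definition L2_isometry (T : (X -> R[i]) -> X -> R[i]) : Prop :=
  L2_operator T /\ forall f, L2 f -> L2norm (T f) = L2norm f.

Definition L2_adjoint (T Tadj : (X -> R[i]) -> X -> R[i]) : Prop :=
  L2_operator Tadj /\
  forall f g, L2 f -> L2 g -> L2inner (T f) g = L2inner f (Tadj g).

(* Unconditional convergence: [totally] is the filter of the finite subsets
   of [I] ordered by inclusion. When [I] is finite it has the largest element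
   [I], and the condition says that the finite sum is [f] almost everywhere. *)
Definition L2_sums_to (I : countType) (u : I -> X -> R[i]) (f : X -> R[i]) :
    Prop :=
  (forall i, L2 (u i)) /\
  L2norm (fun x => \sum_(i <- enum_fset A) u i x - f x) @[A --> totally] --> 0%E.

Definition cuntz_representation (I : countType)
    (T : I -> (X -> R[i]) -> X -> R[i]) : Prop :=
  (forall i, L2_isometry (T i)) /\
  exists Tadj : I -> (X -> R[i]) -> X -> R[i],
    [/\ forall i, L2_adjoint (T i) (Tadj i),
        forall i j, i != j -> forall f, L2 f ->
          T i (Tadj i (T j (Tadj j f))) = cst 0 %[ae mu] &
        forall f, L2 f -> L2_sums_to (fun i => T i (Tadj i f)) f].

End measure_defs.

Section weighted_composition.
Context (R : realType) d (X : measurableType d) (mu : probability X R).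
Variables (sigma : {mfun X >-> X}) (phi : X -> R).

(* The library's charge structure on the set function [pushforward nu sigma];
   it takes the measurability of sigma as an argument, hence cannot be inferred. *)
Definition pushforward_charge (nu : {charge set X -> \bar R}) :
    {charge set X -> \bar R} :=
  measure_function_pushforward__canonical__charge_Charge nu
    (measurable_funPT sigma).

(* Density with respect to mu of A |-> \int_(sigma^-1 A) h dmu; the value 0 for
   a non-integrable h is arbitrary, see [Sadj_defined]. *)
Definition pushforward_density (h : X -> R) : X -> R :=
  match pselect (mu.-integrable [set: X] (EFin \o h)) with
  | left hint => fine \o Radon_Nikodym (pushforward_charge (induced_charge hint)) mu
  | right _ => cst 0
  end.

Definition sqrt_weight (x : X) : R[i] := (Num.sqrt (phi x))%:C.

Definition S_op (f : X -> R[i]) : X -> R[i] :=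
  fun x => sqrt_weight x * f (sigma x).

Definition Sadj_defined (g : X -> R[i]) : Prop :=
  cmeasurable g /\ cintegrable mu (fun x => sqrt_weight x * g x).

Definition Sadj (g : X -> R[i]) : X -> R[i] := fun x =>
  pushforward_density (fun y => complex.Re (g y * sqrt_weight y)) x +i*
  pushforward_density (fun y => complex.Im (g y * sqrt_weight y)) x.

Definition Ephi (g : X -> R[i]) : X -> R[i] := S_op (Sadj g).

Definition T_op (m f : X -> R[i]) : X -> R[i] :=
  fun x => m x * sqrt_weight x * f (sigma x).

End weighted_composition.

(* Main.v *)
Require Import Defs.
From HB Require Import structures.
From mathcomp Require Import all_boot all_order all_algebra.
From mathcomp Require Import finmap complex.
From mathcomp Require Import all_classical all_reals all_analysis.
From mathcomp Require Import measurable_realfun ring lra.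

Set Implicit Arguments.
Unset Strict Implicit.
Unset Printing Implicit Defensive.

Import Order.TTheory GRing.Theory Num.Theory.
Import numFieldNormedType.Exports.

Local Open Scope classical_set_scope.
Local Open Scope ring_scope.

(** Write [k i] for [m i * sqrt phi]. Then [T_op sigma phi (m i)] is the weighted
    composition operator [f |-> k i * (f \o sigma)], and everything is expressed
    through one construction, the transfer of an integrable function [h]: the
    density with respect to [mu] of the complex measure
    [A |-> \int_(sigma^-1 A) h]. It exists because quasi-invariance makes this
    measure absolutely continuous. Three of its properties carry the proof.
    - Duality, [\int (f \o sigma) h = \int f (transfer h)]
      ([transfer_duality]). For real nonnegative data it is the change of
      variables for Radon-Nikodym derivatives, [ge0_density_duality]; the general
      case follows by splitting into parts.
    - Uniqueness: [transfer h] is determined almost everywhere by the integrals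
      of [h] over the sets [sigma^-1 A] ([transfer_unique]).
    - The module property [transfer ((f \o sigma) h) = f * transfer h]
      ([transferM]), a consequence of the first two.

    Duality identifies the adjoint of [T i] as [g |-> transfer (conj (k i) g)],
    which is [Sadj] applied to [conj (m i) g]. Hence [T i (T i^* f)] is the
    [i]-th term of the series in (ii), so that (ii) is the completeness relation
    of the Cuntz algebra. The module property gives
    [T j^* (T i u) = u * transfer (conj (k j) k i)], and [transfer (conj (k j) k i)]
    is the left-hand side of (i). So (i) says that [T j^* T i] is the identity for
    [i = j] and zero otherwise, that is, that the [T i] are isometries with
    mutually orthogonal ranges. That [T i T i^* T j T j^* = 0] forces
    [T i^* T j = 0] is seen by testing on [T j 1 = k j].

    In the direction from (i) and (ii) to the Cuntz relations, the adjoint formula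
    has to be shown to map L^2 to L^2. No bound on the transfer operator is used
    for this: (ii) asserts that [T i (T i^* f)] is in L^2, and [T i] preserves the
    norm of every measurable function, square integrable or not
    ([L2norm_wcomp]). *)

(** * Complex-valued measurable and integrable functions *)

Section complex_modulus.
Variable R : realType.
Implicit Types z w : R[i].

Lemma cReM z w :
  complex.Re (z * w) = complex.Re z * complex.Re w - complex.Im z * complex.Im w.
Proof. by case: z; case: w. Qed.

Lemma cImM z w :
  complex.Im (z * w) = complex.Re z * complex.Im w + complex.Im z * complex.Re w.
Proof. by case: z => a b; case: w. Qed.

Lemma cReJ z : complex.Re (conjc z) = complex.Re z.
Proof. by case: z. Qed.

Lemma cImJ z : complex.Im (conjc z) = - complex.Im z.
Proof. by case: z. Qed.

Lemma cReD z w : complex.Re (z + w) = complex.Re z + complex.Re w.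
Proof. by case: z; case: w. Qed.

Lemma cImD z w : complex.Im (z + w) = complex.Im z + complex.Im w.
Proof. by case: z; case: w. Qed.

Lemma normc_ge0 z : 0 <= normc z.
Proof. by case: z => a b; exact: sqrtr_ge0. Qed.

Lemma sqr_normc z : normc z ^+ 2 = complex.Re z ^+ 2 + complex.Im z ^+ 2.
Proof. by case: z => a b /=; rewrite sqr_sqrtr// addr_ge0 ?sqr_ge0. Qed.

Lemma ler_normRe z : `|complex.Re z| <= normc z.
Proof.
rewrite -(ler_pXn2r (n := 2)) ?nnegrE ?normc_ge0// sqr_normc.
by rewrite real_normK ?num_real// lerDl sqr_ge0.
Qed.

Lemma ler_normIm z : `|complex.Im z| <= normc z.
Proof.
rewrite -(ler_pXn2r (n := 2)) ?nnegrE ?normc_ge0// sqr_normc.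
by rewrite real_normK ?num_real// lerDr sqr_ge0.
Qed.

Lemma normc_conj z : normc (conjc z) = normc z.
Proof. by case: z => a b /=; rewrite sqrrN. Qed.

Lemma mulc_conj z : z * conjc z = (normc z ^+ 2)%:C%C.
Proof.
by rewrite sqr_normc; case: z => a b /=; apply/eqP; rewrite eq_complex /=;
  apply/andP; split; apply/eqP; ring.
Qed.

(** The crude form of the inequality between the arithmetic and geometric means
    which makes the product of two square integrable functions integrable. *)
Lemma ler_normcM z w : normc (z * w) <= normc z ^+ 2 + normc w ^+ 2.
Proof. rewrite normcM; have := normc_ge0 z; have := normc_ge0 w; nra. Qed.

End complex_modulus.

Section complex_functions.
Context (R : realType) d (X : measurableType d).
Implicit Types f g : X -> R[i].

Lemma cmeasurableM f g :
  cmeasurable f -> cmeasurable g -> cmeasurable (fun x => f x * g x).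
Proof.
move=> [rf jf] [rg jg]; split.
  under eq_fun do rewrite cReM.
  by apply: measurable_funB; exact: measurable_funM.
under eq_fun do rewrite cImM.
by apply: measurable_funD; exact: measurable_funM.
Qed.

Lemma cmeasurableD f g :
  cmeasurable f -> cmeasurable g -> cmeasurable (fun x => f x + g x).
Proof.
move=> [rf jf] [rg jg]; split.
  by under eq_fun do rewrite cReD; exact: measurable_funD.
by under eq_fun do rewrite cImD; exact: measurable_funD.
Qed.

Lemma cmeasurableJ f : cmeasurable f -> cmeasurable (fun x => conjc (f x)).
Proof.
move=> [rf jf]; split; first by under eq_fun do rewrite cReJ.
by under eq_fun do rewrite cImJ; exact: measurable_funN.
Qed.

Lemma cmeasurable_cst (c : R[i]) : cmeasurable (fun _ : X => c).
Proof. by split; exact: measurable_cst. Qed.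

Lemma cmeasurable_real (r : X -> R) :
  measurable_fun setT r -> cmeasurable (fun x => (r x)%:C%C).
Proof. by move=> mr; split => //=; exact: measurable_cst. Qed.

Lemma cmeasurable_comp f (s : {mfun X >-> X}) :
  cmeasurable f -> cmeasurable (f \o s).
Proof. by move=> [rf jf]; split; [exact: (measurableT_comp rf)|exact: (measurableT_comp jf)]. Qed.

Lemma measurable_sqrt : measurable_fun [set: R] (@Num.sqrt R).
Proof. by apply: continuous_measurable_fun; exact: sqrt_continuous. Qed.

Lemma measurable_sqr_normc f :
  cmeasurable f -> measurable_fun setT (fun x => normc (f x) ^+ 2).
Proof.
move=> [rf jf]; under eq_fun do rewrite sqr_normc.
by apply: measurable_funD; exact: measurable_funX.
Qed.

Lemma measurable_normc f : cmeasurable f -> measurable_fun setT (fun x => normc (f x)).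
Proof.
move=> /measurable_sqr_normc mf.
rewrite (_ : (fun x => normc (f x)) = Num.sqrt \o (fun x => normc (f x) ^+ 2)).
  exact: (measurableT_comp measurable_sqrt).
by apply/funext => x /=; rewrite sqrtr_sqr ger0_norm// normc_ge0.
Qed.

End complex_functions.

Section complex_integral.
Context (R : realType) d (X : measurableType d) (mu : probability X R).
Implicit Types f g : X -> R[i].

(** Domination for real functions; every integrability claim below reduces to it. *)
Lemma integrable_dominated (u v : X -> R) : measurable_fun setT u ->
  (forall x, `|u x| <= v x) ->
  mu.-integrable setT (EFin \o v) -> mu.-integrable setT (EFin \o u).
Proof.
move=> mu_ uv; apply: le_integrable => //; first exact/measurable_EFinP.
by move=> x _ /=; rewrite lee_fin (le_trans (uv x))// ler_norm.
Qed.

Lemma cintegrable_cmeasurable f : cintegrable mu f -> cmeasurable f.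
Proof. by move=> [/measurable_int/measurable_EFinP ? /measurable_int/measurable_EFinP]. Qed.

Lemma cintegrable_dominated f (v : X -> R) : cmeasurable f ->
  (forall x, normc (f x) <= v x) ->
  mu.-integrable setT (EFin \o v) -> cintegrable mu f.
Proof.
move=> [rf jf] fv iv; split; apply: (integrable_dominated _ _ iv) => // x.
- exact: le_trans (ler_normRe _) _.
- exact: le_trans (ler_normIm _) _.
Qed.

Lemma integrable_normc f : cintegrable mu f ->
  mu.-integrable setT (EFin \o (fun x => normc (f x))).
Proof.
move=> /[dup] /cintegrable_cmeasurable mf [rf jf].
apply: (@integrable_dominated _
  (fun x => `|complex.Re (f x)| + `|complex.Im (f x)|)).
- exact: measurable_normc.
- move=> x /=; rewrite ger0_norm ?normc_ge0//.
  rewrite -(ler_pXn2r (n := 2)) ?nnegrE ?normc_ge0 ?addr_ge0//.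
  rewrite sqr_normc -(real_normK (num_real (complex.Re _))).
  rewrite -(real_normK (num_real (complex.Im _))).
  by move: (normr_ge0 (complex.Re (f x))) (normr_ge0 (complex.Im (f x))); nra.
- rewrite (_ : EFin \o _ = (fun x => (abse (complex.Re (f x))%:E) + (abse (complex.Im (f x))%:E))%E).
    by apply: integrableD => //; exact: integrable_abse.
  by apply/funext => x /=; rewrite EFinD.
Qed.

Lemma cintegrableD f g : cintegrable mu f -> cintegrable mu g ->
  cintegrable mu (fun x => f x + g x).
Proof.
move=> [rf jf] [rg jg]; split.
  by under eq_fun do rewrite cReD EFinD; exact: integrableD.
by under eq_fun do rewrite cImD EFinD; exact: integrableD.
Qed.

Lemma cintegralD f g : cintegrable mu f -> cintegrable mu g ->
  cintegral mu (fun x => f x + g x) = cintegral mu f + cintegral mu g.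
Proof.
move=> [rf jf] [rg jg]; rewrite /cintegral.
under eq_Rintegral do rewrite cReD.
under [in X in Complex _ X]eq_Rintegral do rewrite cImD.
by rewrite !RintegralD.
Qed.

Lemma cintegrableM_bounded f g (M : R) : cmeasurable f ->
  (forall x, normc (f x) <= M) ->
  cintegrable mu g -> cintegrable mu (fun x => f x * g x).
Proof.
move=> mf fM ig.
apply: (@cintegrable_dominated _ (fun x => M * normc (g x))).
- exact/cmeasurableM/cintegrable_cmeasurable/ig.
- by move=> x; rewrite normcM ler_wpM2r ?normc_ge0.
- under [EFin \o _]eq_fun do rewrite EFinM.
  by apply: integrableZl => //; exact: integrable_normc.
Qed.

Lemma cintegrableZ (c : R[i]) f :
  cintegrable mu f -> cintegrable mu (fun x => c * f x).
Proof.
by apply: (@cintegrableM_bounded (fun=> c) f (normc c)) => //; exact: cmeasurable_cst.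
Qed.

Lemma cintegralZ (c : R[i]) f : cintegrable mu f ->
  cintegral mu (fun x => c * f x) = c * cintegral mu f.
Proof.
move=> [rf jf]; rewrite /cintegral.
under eq_Rintegral do rewrite cReM.
under [in X in Complex _ X]eq_Rintegral do rewrite cImM.
have iZ a (u : X -> R) : mu.-integrable setT (EFin \o u) ->
    mu.-integrable setT (EFin \o (fun x => a * u x)).
  by move=> iu; under [EFin \o _]eq_fun do rewrite EFinM; exact: integrableZl.
rewrite RintegralB ?RintegralD ?RintegralZl//; [|exact: iZ..].
by case: c.
Qed.

Lemma cintegrableJ f :
  cintegrable mu f -> cintegrable mu (fun x => conjc (f x)).
Proof.
move=> [rf jf]; split; first by under eq_fun do rewrite cReJ.
by under eq_fun do rewrite cImJ EFinN; exact: integrableN.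
Qed.

Lemma cintegralJ f : cintegrable mu f ->
  cintegral mu (fun x => conjc (f x)) = conjc (cintegral mu f).
Proof.
move=> [rf jf]; rewrite /cintegral /=; under eq_Rintegral do rewrite cReJ.
under [in X in Complex _ X]eq_Rintegral do rewrite cImJ -mulN1r.
by rewrite RintegralZl// mulN1r.
Qed.

Lemma eq_cintegral_ae f g : cmeasurable f -> cmeasurable g ->
  f = g %[ae mu] -> cintegral mu f = cintegral mu g.
Proof.
move=> [rf jf] [rg jg] fg; congr (Complex (fine _) (fine _));
  apply: ae_eq_integral => //; try exact/measurable_EFinP.
- by apply: filterS fg => x /[apply] ->.
- by apply: filterS fg => x /[apply] ->.
Qed.

End complex_integral.

(** * Square integrable functions *)

Section square_integrable.
Context (R : realType) d (X : measurableType d) (mu : probability X R).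
Implicit Types f g : X -> R[i].

(** The square removes the root in the definition of the norm, so that equality of
    norms can be traded for equality of integrals. *)
Lemma L2norm_pow f :
  (L2norm mu f `^ 2 = \int[mu]_x (normc (f x) ^+ 2)%:E)%E.
Proof.
rewrite /L2norm poweR_Lnorm//; apply: eq_integral => x _.
by rewrite abse_EFin ger0_norm ?normc_ge0// poweR_EFin powR_mulrn ?normc_ge0.
Qed.

Lemma L2normE f :
  L2norm mu f = ((\int[mu]_x (normc (f x) ^+ 2)%:E) `^ 2^-1)%E.
Proof.
by rewrite -L2norm_pow -poweRrM mulfV// poweRe1// /L2norm Lnorm_ge0.
Qed.

Lemma L2_integrable f : L2 mu f <->
  cmeasurable f /\ mu.-integrable setT (EFin \o (fun x => normc (f x) ^+ 2)).
Proof.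
have E : (\int[mu]_x `|(normc (f x) ^+ 2)%:E| =
    \int[mu]_x (normc (f x) ^+ 2)%:E)%E.
  by apply: eq_integral => x _; rewrite /= ger0_norm// sqr_ge0.
split=> -[mf fy]; split=> //.
- apply/integrableP; split; first exact/measurable_EFinP/measurable_sqr_normc.
  by rewrite E -L2norm_pow poweR_lty.
- by rewrite L2normE poweR_lty// -E; case/integrableP: fy.
Qed.

Lemma cintegrable_L2M f g : L2 mu f -> L2 mu g ->
  cintegrable mu (fun x => f x * g x).
Proof.
move=> /L2_integrable[mf i_f] /L2_integrable[mg ig].
apply: (@cintegrable_dominated _ _ _ _ _ (fun x => normc (f x) ^+ 2 + normc (g x) ^+ 2)).
- exact: cmeasurableM.
- by move=> x; exact: ler_normcM.
- by under [EFin \o _]eq_fun do rewrite EFinD; exact: integrableD.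
Qed.

Lemma L2J f : L2 mu f -> L2 mu (fun x => conjc (f x)).
Proof.
move=> /L2_integrable[mf i_f]; apply/L2_integrable; split; first exact: cmeasurableJ.
by under [EFin \o _]eq_fun do rewrite normc_conj.
Qed.

Lemma L2_bounded f (M : R) : cmeasurable f -> (forall x, normc (f x) <= M) ->
  L2 mu f.
Proof.
move=> mf fM; apply/L2_integrable; split=> //.
apply: (@integrable_dominated _ _ _ _ _ (fun=> M ^+ 2)).
- exact: measurable_sqr_normc.
- move=> x; rewrite ger0_norm ?sqr_ge0// ler_pXn2r ?nnegrE ?normc_ge0//.
  exact: le_trans (normc_ge0 _) (fM x).
- exact: finite_measure_integrable_cst.
Qed.

Lemma L2_cst (c : R[i]) : L2 mu (fun=> c).
Proof.
by apply: (@L2_bounded _ (normc c)) => //; exact: cmeasurable_cst.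
Qed.

Lemma eq_L2norm_ae f g : cmeasurable f -> cmeasurable g -> f = g %[ae mu] ->
  L2norm mu f = L2norm mu g.
Proof.
move=> mf mg fg; rewrite !L2normE; congr (_ `^ _)%E.
apply: ae_eq_integral => //; try exact/measurable_EFinP/measurable_sqr_normc.
by apply: filterS fg => x /[apply] ->.
Qed.

End square_integrable.

(** * The density of a pushed forward real measure *)

Section nonnegative_charge.
Context (R : realType) d (X : measurableType d).
Variables (nu : {charge set X -> \bar R}) (nu_ge0 : forall A, (0 <= nu A)%E).

Let measure_of_charge_fin : fin_num_fun (measure_of_charge nu nu_ge0).
Proof. by move=> A mA; exact: fin_num_measure. Qed.

(** Charges are finite, so a nonnegative one is a finite measure, as the
    change-of-variables theorem for Radon-Nikodym derivatives demands. *)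
HB.instance Definition _ :=
  Measure_isFinite.Build _ _ _ (measure_of_charge nu nu_ge0)
    measure_of_charge_fin.

End nonnegative_charge.

Section real_transfer.
Context (R : realType) d (X : measurableType d) (mu : probability X R).
Variable sigma : {mfun X >-> X}.
Hypothesis sigma_qi : quasi_invariant mu sigma.
Implicit Types (h u F : X -> R) (A : set X).

Local Notation density := (pushforward_density mu sigma).

Lemma measurable_preimage A : measurable A -> measurable (sigma @^-1` A).
Proof. by move=> mA; rewrite -(setTI (_ @^-1` _)); exact: (measurable_funP sigma). Qed.

(** One half of quasi-invariance is used here: preimages of null sets are null, so
    that composition with [sigma] is well defined on classes modulo null sets. *)
Lemma ae_comp (P : set X) :
  (\forall x \ae mu, P x) -> \forall x \ae mu, P (sigma x).
Proof.
move=> [N [mN N0 PN]]; exists (sigma @^-1` N); split.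
- exact: measurable_preimage.
- exact/(sigma_qi mN).
- by move=> x Px; exact: PN.
Qed.

(** Quasi-invariance again: it is what makes the Radon-Nikodym derivative exist. *)
Lemma pushforward_charge_dominated h (ih : mu.-integrable setT (EFin \o h)) :
  pushforward_charge sigma (induced_charge ih) `<< mu.
Proof.
apply/null_content_dominatesP => A mA A0.
apply: null_set_integral.
- exact: measurable_preimage.
- exact/measurable_funTS/(measurable_int mu).
- exact/(sigma_qi mA).
Qed.

Lemma pushforward_densityE h (ih : mu.-integrable setT (EFin \o h)) x :
  (density h x)%:E =
  Radon_Nikodym (pushforward_charge sigma (induced_charge ih)) mu x.
Proof.
rewrite /pushforward_density; case: pselect => //= ih'.
rewrite (Prop_irrelevance ih' ih) fineK// Radon_Nikodym_fin_num//.
exact: pushforward_charge_dominated.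
Qed.

Lemma integrable_density h : mu.-integrable setT (EFin \o density h).
Proof.
have [ih|nih] := pselect (mu.-integrable setT (EFin \o h)).
  rewrite (_ : EFin \o _ =
      Radon_Nikodym (pushforward_charge sigma (induced_charge ih)) mu).
    exact/Radon_Nikodym_integrable/pushforward_charge_dominated.
  by apply/funext => x; exact: pushforward_densityE.
rewrite /pushforward_density; case: pselect => // _.
exact: finite_measure_integrable_cst.
Qed.

Lemma measurable_density h : measurable_fun setT (density h).
Proof. exact/measurable_EFinP/(measurable_int _ (integrable_density h)). Qed.

Lemma integral_density h A : mu.-integrable setT (EFin \o h) -> measurable A ->
  (\int[mu]_(x in A) (density h x)%:E = \int[mu]_(x in sigma @^-1` A) (h x)%:E)%E.
Proof.
move=> ih mA; under eq_integral do rewrite (pushforward_densityE ih).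
by rewrite -Radon_Nikodym_integral//; exact: pushforward_charge_dominated.
Qed.

Lemma density_unique h u : mu.-integrable setT (EFin \o h) ->
  mu.-integrable setT (EFin \o u) ->
  (forall A, measurable A ->
    \int[mu]_(x in A) (u x)%:E = \int[mu]_(x in sigma @^-1` A) (h x)%:E)%E ->
  density h = u %[ae mu].
Proof.
move=> ih iu hu.
have : (EFin \o density h) = (EFin \o u) %[ae mu].
  apply: integral_ae_eq => //; first exact: integrable_density.
  - exact: measurable_int iu.
  - by move=> A _ mA /=; rewrite integral_density// hu.
by apply: filterS => x /[apply] -[].
Qed.

(** For [h >= 0], both [K A = \int_A h] and [N A = \int_(sigma^-1 A) h] are finite
    measures, and [N] is the image of [K] under [sigma]. Hence
    [\int (F \o sigma) h dmu = \int (F \o sigma) dK = \int F dN = \int F p dmu]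
    with [p = dN/dmu], and [p] is the density by uniqueness. The version [p] is
    returned because it is nonnegative everywhere, the density itself only almost
    everywhere; [F] need not be integrable. *)
Lemma ge0_density_duality h : mu.-integrable setT (EFin \o h) ->
  (forall x, 0 <= h x) ->
  exists p : X -> R, [/\ density h = p %[ae mu], forall x, 0 <= p x,
    measurable_fun setT p &
    forall F, measurable_fun setT F -> (forall x, 0 <= F x) ->
    (\int[mu]_x (F (sigma x) * h x)%:E = \int[mu]_x (F x * p x)%:E)%E].
Proof.
move=> ih h0; pose k := induced_charge ih.
have k0 A : (0 <= k A)%E by apply: integral_ge0 => x _; rewrite /= lee_fin.
pose nu := pushforward_charge sigma k.
have nu0 A : (0 <= nu A)%E by exact: k0.
pose K := measure_of_charge _ k0; pose N := measure_of_charge nu nu0.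
have Kmu : K `<< mu.
  apply/null_content_dominatesP => A mA A0; apply: null_set_integral => //.
  exact/measurable_funTS/(measurable_int mu).
have Nmu : N `<< mu by exact: pushforward_charge_dominated.
pose p := Radon_Nikodym_SigmaFinite.f N mu.
have pE x : (fine (p x))%:E = p x.
  by rewrite fineK// Radon_Nikodym_SigmaFinite.f_fin_num.
have mp : measurable_fun setT p.
  exact/measurable_int/(Radon_Nikodym_SigmaFinite.f_integrable Nmu).
exists (fine \o p); split.
- apply: density_unique => //.
    rewrite (_ : EFin \o _ = p); last exact/funext.
    exact: Radon_Nikodym_SigmaFinite.f_integrable.
  move=> A mA; under eq_integral do rewrite pE.
  by rewrite -Radon_Nikodym_SigmaFinite.f_integral.
- by move=> x; rewrite fine_ge0// Radon_Nikodym_SigmaFinite.f_ge0.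
- by apply/measurable_EFinP; rewrite (_ : EFin \o _ = p)//; exact/funext.
move=> F mF F0; transitivity (\int[N]_x (F x)%:E)%E; last first.
  rewrite -(Radon_Nikodym_SigmaFinite.change_of_variables Nmu)//.
    by apply: eq_integral => x _; rewrite EFinM pE.
  exact/measurable_EFinP.
transitivity (\int[K]_x (F (sigma x))%:E)%E.
  rewrite -(Radon_Nikodym_SigmaFinite.change_of_variables Kmu)//; last 2 first.
  - by move=> x; rewrite lee_fin.
  - exact/measurable_EFinP/measurableT_comp.
  have iK := Radon_Nikodym_SigmaFinite.f_integrable Kmu.
  apply: ae_eq_integral => //.
  - apply/measurable_EFinP/measurable_funM; first exact: measurableT_comp.
    exact/measurable_EFinP/(measurable_int _ ih).
  - apply: emeasurable_funM; last exact: measurable_int iK.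
    exact/measurable_EFinP/measurableT_comp.
  have : (EFin \o h) = Radon_Nikodym_SigmaFinite.f K mu %[ae mu].
    apply: integral_ae_eq => //; first exact: measurable_int iK.
    by move=> A _ mA; rewrite -Radon_Nikodym_SigmaFinite.f_integral.
  by apply: filterS => x /[apply] <-; rewrite EFinM.
have <- := @ge0_integral_pushforward _ _ _ _ R sigma (measurable_funPT sigma) K setT
  (EFin \o F) measurableT; first exact: eq_measure_integral.
- exact/measurable_EFinP.
- by move=> x _; rewrite /= lee_fin.
Qed.

End real_transfer.

(** * Duality between composition and density *)

Section equal_integrals.
Context (R : realType) d (X : measurableType d) (mu : probability X R).
Implicit Types u v : X -> R.

(** Duality is an equality of integrals together with two integrability claims;
    this conjunction is stable under sums and differences, which lets it pass from
    nonnegative to signed to complex functions. *)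
Definition equal_integrals u v := [/\ mu.-integrable setT (EFin \o u),
  mu.-integrable setT (EFin \o v) & \int[mu]_x u x = \int[mu]_x v x].

Lemma equal_integralsB u1 v1 u2 v2 :
  equal_integrals u1 v1 -> equal_integrals u2 v2 ->
  equal_integrals (fun x => u1 x - u2 x) (fun x => v1 x - v2 x).
Proof.
move=> [iu1 iv1 e1] [iu2 iv2 e2]; split; last by rewrite !RintegralB// e1 e2.
- by under [EFin \o _]eq_fun do rewrite EFinB; exact: (integrableB _ iu1 iu2).
- by under [EFin \o _]eq_fun do rewrite EFinB; exact: (integrableB _ iv1 iv2).
Qed.

Lemma equal_integralsD u1 v1 u2 v2 :
  equal_integrals u1 v1 -> equal_integrals u2 v2 ->
  equal_integrals (fun x => u1 x + u2 x) (fun x => v1 x + v2 x).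
Proof.
move=> [iu1 iv1 e1] [iu2 iv2 e2]; split; last by rewrite !RintegralD// e1 e2.
- by under [EFin \o _]eq_fun do rewrite EFinD; exact: (integrableD _ iu1 iu2).
- by under [EFin \o _]eq_fun do rewrite EFinD; exact: (integrableD _ iv1 iv2).
Qed.

Lemma eq_equal_integrals u1 u2 v :
  u1 =1 u2 -> equal_integrals u1 v -> equal_integrals u2 v.
Proof. by move=> /funext ->. Qed.

Lemma equal_integrals_ae u v w : measurable_fun setT w -> v = w %[ae mu] ->
  equal_integrals u v -> equal_integrals u w.
Proof.
move=> mw vw [iu iv e].
have mv := measurable_int _ iv.
have vwE : (EFin \o v) = (EFin \o w) %[ae mu].
  by apply: filterS vw => x /[apply] /= ->.
have ew : (\int[mu]_x (v x)%:E = \int[mu]_x (w x)%:E)%E.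
  by apply: ae_eq_integral => //; exact/measurable_EFinP.
split=> //; last by rewrite e /Rintegral ew.
apply/integrableP; split; first exact/measurable_EFinP.
case/integrableP: iv => _; apply: le_lt_trans.
rewrite le_eqVlt; apply/orP; left; apply/eqP/esym/ae_eq_integral => //.
- exact: measurableT_comp.
- by apply: measurableT_comp => //; exact/measurable_EFinP.
- by apply: filterS vw => x /[apply] /= ->.
Qed.

End equal_integrals.

Section duality.
Context (R : realType) d (X : measurableType d) (mu : probability X R).
Variable sigma : {mfun X >-> X}.
Hypothesis sigma_qi : quasi_invariant mu sigma.
Implicit Types h u F : X -> R.

Local Notation density := (pushforward_density mu sigma).

Lemma densityB h u : mu.-integrable setT (EFin \o h) ->
  mu.-integrable setT (EFin \o u) ->
  density (fun x => h x - u x) = (fun x => density h x - density u x) %[ae mu].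
Proof.
move=> ih iu; apply: density_unique => //.
- by under [EFin \o _]eq_fun do rewrite EFinB; exact: (integrableB _ ih iu).
- under [EFin \o _]eq_fun do rewrite EFinB.
  by apply: (integrableB _ (integrable_density _ _) (integrable_density _ _)).
move=> A mA; have mA' := measurable_preimage sigma mA.
under eq_integral do rewrite EFinB.
under [RHS]eq_integral do rewrite EFinB.
by rewrite !integralB ?integral_density//;
  apply: (integrableS measurableT) => //; exact: integrable_density.
Qed.

Lemma density_duality_ge0 h F : measurable_fun setT F ->
  (forall x, 0 <= F x) -> (forall x, 0 <= h x) ->
  mu.-integrable setT (EFin \o h) ->
  mu.-integrable setT (EFin \o (fun x => F (sigma x) * h x)) ->
  equal_integrals mu (fun x => F (sigma x) * h x) (fun x => F x * density h x).
Proof.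
move=> mF F0 h0 ih iFh.
have [p [hp p0 mp pE]] := ge0_density_duality sigma_qi ih h0.
apply: (@equal_integrals_ae _ _ _ _ _ (fun x => F x * p x)).
- by apply: measurable_funM => //; exact: measurable_density.
- by apply: filterS hp => x /[apply] ->.
split=> //; last by rewrite /Rintegral pE.
apply/integrableP; split; first exact/measurable_EFinP/measurable_funM.
case/integrableP: iFh => _; apply: le_lt_trans.
rewrite le_eqVlt; apply/orP; left; apply/eqP.
transitivity (\int[mu]_x (F x * p x)%:E)%E.
  by apply: eq_integral => x _; rewrite /= ger0_norm ?mulr_ge0.
by rewrite -pE//; apply: eq_integral => x _; rewrite /= ger0_norm ?mulr_ge0.
Qed.

(** The positive part, in a form for which [ring] proves the decomposition
    [posrB]; the negative part of [r] is [posr (- r)]. *)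
Definition posr (r : R) := (`|r| + r) / 2.

Lemma posr_ge0 r : 0 <= posr r.
Proof. by rewrite divr_ge0// -lerBlDr sub0r -normrN ler_norm. Qed.

Lemma posr_le r : posr r <= `|r|.
Proof. by rewrite /posr; have := ler_norm r; lra. Qed.

Lemma posrB r : posr r - posr (- r) = r.
Proof. by rewrite /posr normrN; field. Qed.

Lemma measurable_posr u : measurable_fun setT u -> measurable_fun setT (posr \o u).
Proof.
move=> mu_; apply: measurable_funM => //; apply: measurable_funD => //.
exact: measurableT_comp.
Qed.

(** Splitting [F] and [h] into positive and negative parts gives four products.
    Each is dominated by [|(F \o sigma) h|], so each is integrable and
    the nonnegative case applies to it. *)
Lemma density_duality h F : measurable_fun setT F ->
  mu.-integrable setT (EFin \o h) ->
  mu.-integrable setT (EFin \o (fun x => F (sigma x) * h x)) ->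
  equal_integrals mu (fun x => F (sigma x) * h x) (fun x => F x * density h x).
Proof.
move=> mF ih iFh.
have mh : measurable_fun setT h by exact/measurable_EFinP/(measurable_int _ ih).
have inh : mu.-integrable setT (EFin \o (fun x => `|h x|)) by exact: integrable_norm.
have inFh := integrable_norm iFh.
have mN (u : X -> R) : measurable_fun setT u -> measurable_fun setT (fun x => - u x).
  exact: measurable_funN.
have ip (u : X -> R) : measurable_fun setT u -> (forall x, `|u x| = `|h x|) ->
    mu.-integrable setT (EFin \o (posr \o u)).
  move=> mu_ uh; apply: (integrable_dominated _ _ inh).
  - exact: measurable_posr.
  - by move=> x /=; rewrite ger0_norm ?posr_ge0// -uh posr_le.
have D (u v : X -> R) : measurable_fun setT u -> measurable_fun setT v ->
    (forall x, `|u x| = `|h x|) -> (forall x, `|v x| = `|F x|) ->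
  equal_integrals mu (fun x => posr (v (sigma x)) * posr (u x))
      (fun x => posr (v x) * density (posr \o u) x).
  move=> mu_ mv uh vF; apply: (@density_duality_ge0 (posr \o u) (posr \o v)).
  - exact: measurable_posr.
  - by move=> x; exact: posr_ge0.
  - by move=> x; exact: posr_ge0.
  - exact: ip.
  apply: (integrable_dominated _ _ inFh).
  - apply: measurable_funM; last exact: measurable_posr.
    exact: (measurableT_comp (measurable_posr mv)).
  - move=> x /=; rewrite ger0_norm; last exact: mulr_ge0 (posr_ge0 _) (posr_ge0 _).
    by rewrite normrM -vF -uh ler_pM ?posr_ge0 ?posr_le.
have N0 : forall (u : X -> R) x, `|- u x| = `|u x|.
  by move=> u x; rewrite normrN.
apply: equal_integrals_ae; last first.
- apply: eq_equal_integrals; last first.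
    apply: equal_integralsB.
      apply: equal_integralsB; [exact: (D h F)|].
      exact: (D (fun x => - h x) F (mN _ mh)).
    apply: equal_integralsB; [exact: (D h (fun x => - F x) _ (mN _ mF))|].
    exact: (D (fun x => - h x) (fun x => - F x) (mN _ mh) (mN _ mF)).
  move=> x; rewrite /= -[in RHS](posrB (F (sigma x))) -[in RHS](posrB (h x)).
  by ring.
- have : density (fun x => posr (h x) - posr (- h x)) =
      (fun x => density (posr \o h) x - density (posr \o (fun y => - h y)) x) %[ae mu].
    by apply: densityB; apply: ip => //; exact: mN.
  rewrite (_ : (fun x => posr (h x) - posr (- h x)) = h); last first.
    by apply/funext => x; exact: posrB.
  apply: filterS => x /[apply] ->.
  by rewrite /= -[in RHS](posrB (F x)); ring.
- by apply: measurable_funM => //; exact: measurable_density.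
Qed.

End duality.

(** * The transfer operator on complex functions *)

Section complex_transfer.
Context (R : realType) d (X : measurableType d) (mu : probability X R).
Variable sigma : {mfun X >-> X}.
Hypothesis sigma_qi : quasi_invariant mu sigma.
Implicit Types (f g h : X -> R[i]) (A : set X).

Local Notation density := (pushforward_density mu sigma).

Definition transfer h x : R[i] :=
  Complex (density (fun y => complex.Re (h y)) x)
    (density (fun y => complex.Im (h y)) x).

(** The indicator function as a complex function, so that integrals over sets are
    instances of the pairing in [transfer_duality]. *)
Definition cindic A x : R[i] := (\1_A x)%:C%C.

Lemma cmeasurable_cindic A : measurable A -> cmeasurable (cindic A).
Proof. by move=> mA; apply/cmeasurable_real/measurable_indic. Qed.

Lemma normc_real (r : R) : 0 <= r -> normc r%:C%C = r.
Proof. by move=> r0; rewrite /= expr0n addr0 sqrtr_sqr ger0_norm. Qed.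

Lemma normc_cindic_le1 A x : normc (cindic A x) <= 1.
Proof. by rewrite normc_real indicE; case: (_ \in _). Qed.

Lemma L2_cindic A : measurable A -> L2 mu (cindic A).
Proof.
move=> mA; apply: (@L2_bounded _ _ _ _ _ 1); first exact: cmeasurable_cindic.
exact: normc_cindic_le1.
Qed.

Lemma cintegrable_transfer h : cintegrable mu (transfer h).
Proof. by split; exact: integrable_density. Qed.

Lemma cmeasurable_transfer h : cmeasurable (transfer h).
Proof. exact/cintegrable_cmeasurable/cintegrable_transfer. Qed.

(** The real and imaginary parts of the product are combinations of four real
    products, each dominated by [|(f \o sigma) h|]. *)
Lemma transfer_duality f h : cmeasurable f -> cintegrable mu h ->
  cintegrable mu (fun x => f (sigma x) * h x) ->
  cintegrable mu (fun x => f x * transfer h x) /\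
  cintegral mu (fun x => f (sigma x) * h x) =
  cintegral mu (fun x => f x * transfer h x).
Proof.
move=> [rf jf] ih ifh; have [rh jh] := ih.
have nfh := integrable_normc ifh.
have part (a b : X -> R) : measurable_fun setT a -> mu.-integrable setT (EFin \o b) ->
    (forall x, `|a x| <= normc (f x)) -> (forall x, `|b x| <= normc (h x)) ->
  equal_integrals mu (fun x => a (sigma x) * b x) (fun x => a x * density b x).
  move=> ma ib af bh; apply: density_duality => //.
  apply: (integrable_dominated _ _ nfh).
  - apply: measurable_funM; first exact: measurableT_comp.
    exact/measurable_EFinP/(measurable_int _ ib).
  - by move=> x; rewrite normrM normcM ler_pM.
have Rf x := ler_normRe (f x). have If x := ler_normIm (f x).
have Rh x := ler_normRe (h x). have Ih x := ler_normIm (h x).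
have [i1 i2 e12] := equal_integralsB (part _ _ rf rh Rf Rh) (part _ _ jf jh If Ih).
have [i3 i4 e34] := equal_integralsD (part _ _ rf jh Rf Ih) (part _ _ jf rh If Rh).
split.
  split; first by under eq_fun do rewrite cReM.
  by under eq_fun do rewrite cImM.
rewrite /cintegral; congr Complex.
- by under eq_Rintegral do rewrite cReM; under [RHS]eq_Rintegral do rewrite cReM.
- by under eq_Rintegral do rewrite cImM; under [RHS]eq_Rintegral do rewrite cImM.
Qed.

Lemma integral_cindic A h : measurable A -> cintegrable mu h ->
  cintegral mu (fun x => cindic A x * h x) =
  Complex (\int[mu]_(x in A) complex.Re (h x)) (\int[mu]_(x in A) complex.Im (h x)).
Proof.
move=> mA ih; rewrite /cintegral; congr Complex.
- rewrite [RHS]Rintegral_mkcond; apply: eq_Rintegral => x _.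
  by rewrite cReM /= patchE mul0r subr0 indicE; case: (_ \in _); rewrite ?mul1r ?mul0r.
- rewrite [RHS]Rintegral_mkcond; apply: eq_Rintegral => x _.
  by rewrite cImM /= patchE mul0r addr0 indicE; case: (_ \in _); rewrite ?mul1r ?mul0r.
Qed.

Lemma cindic_preimage A x : cindic A (sigma x) = cindic (sigma @^-1` A) x.
Proof. by rewrite /cindic !indicE. Qed.

(** Taking real and imaginary parts reduces this to uniqueness of a real density.
    All identities between transfers below are obtained from it, by testing against
    indicator functions. *)
Lemma transfer_unique h g : cintegrable mu h -> cintegrable mu g ->
  (forall A, measurable A ->
     cintegral mu (fun x => cindic A (sigma x) * h x) =
     cintegral mu (fun x => cindic A x * g x)) ->
  transfer h = g %[ae mu].
Proof.
move=> ih ig hg.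
have E (u v : X -> R) A : mu.-integrable setT (EFin \o u) ->
    mu.-integrable setT (EFin \o v) -> measurable A ->
    \int[mu]_(x in sigma @^-1` A) u x = \int[mu]_(x in A) v x ->
    (\int[mu]_(x in A) (v x)%:E = \int[mu]_(x in sigma @^-1` A) (u x)%:E)%E.
  move=> iu iv mA uv; have mA' := measurable_preimage sigma mA.
  rewrite -[LHS]fineK; last exact/integrable_fin_num/(integrableS measurableT).
  rewrite -[RHS]fineK; last exact/integrable_fin_num/(integrableS measurableT).
  by congr EFin.
have {}hg A : measurable A ->
    Complex (\int[mu]_(x in sigma @^-1` A) complex.Re (h x))
      (\int[mu]_(x in sigma @^-1` A) complex.Im (h x)) =
    Complex (\int[mu]_(x in A) complex.Re (g x)) (\int[mu]_(x in A) complex.Im (g x)).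
  move=> mA; have := hg A mA; rewrite integral_cindic// => <-.
  by rewrite -integral_cindic//; exact: measurable_preimage.
have [rh jh] := ih; have [rg jg] := ig.
have Re_ae : density (fun y => complex.Re (h y)) = (fun y => complex.Re (g y)) %[ae mu].
  apply: (density_unique sigma_qi rh rg) => A mA; apply: (E _ _ _ rh rg mA).
  by case: (hg A mA).
have Im_ae : density (fun y => complex.Im (h y)) = (fun y => complex.Im (g y)) %[ae mu].
  apply: (density_unique sigma_qi jh jg) => A mA; apply: (E _ _ _ jh jg mA).
  by case: (hg A mA).
apply: filterS2 Re_ae Im_ae => x rE iE _.
by rewrite /transfer rE// iE//; case: (g x).
Qed.

Lemma cintegrable_cindicM A h : measurable A -> cintegrable mu h ->
  cintegrable mu (fun x => cindic A x * h x).
Proof.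
move=> mA; apply: (@cintegrableM_bounded _ _ _ _ _ _ 1).
- exact: cmeasurable_cindic.
- exact: normc_cindic_le1.
Qed.

Lemma cintegrable_cindic_compM A h : measurable A -> cintegrable mu h ->
  cintegrable mu (fun x => cindic A (sigma x) * h x).
Proof.
move=> mA ih; under eq_fun do rewrite cindic_preimage.
by apply: cintegrable_cindicM => //; exact: measurable_preimage.
Qed.

Lemma transfer_indic A h : measurable A -> cintegrable mu h ->
  cintegral mu (fun x => cindic A (sigma x) * h x) =
  cintegral mu (fun x => cindic A x * transfer h x).
Proof.
move=> mA ih; apply: (transfer_duality _ ih _).2.
- exact: cmeasurable_cindic.
- exact: cintegrable_cindic_compM.
Qed.

Lemma transfer_ae h g : cintegrable mu h -> cintegrable mu g ->
  h = g %[ae mu] -> transfer h = transfer g %[ae mu].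
Proof.
move=> ih ig hg; apply: transfer_unique => //; first exact: cintegrable_transfer.
move=> A mA; rewrite -transfer_indic//; apply: eq_cintegral_ae.
- exact/cintegrable_cmeasurable/cintegrable_cindic_compM.
- exact/cintegrable_cmeasurable/cintegrable_cindic_compM.
- by apply: filterS hg => x /[apply] ->.
Qed.

Lemma transfer_linear (c : R[i]) h g : cintegrable mu h -> cintegrable mu g ->
  transfer (fun x => c * h x + g x) =
  (fun x => c * transfer h x + transfer g x) %[ae mu].
Proof.
move=> ih ig; have ih' := cintegrable_transfer h.
have ig' := cintegrable_transfer g.
apply: transfer_unique => [||A mA].
- by apply: cintegrableD => //; exact: cintegrableZ.
- by apply: cintegrableD => //; exact: cintegrableZ.
have mulE (a b e : R[i]) : e * (c * a + b) = c * (e * a) + e * b by ring.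
under eq_fun do rewrite mulE; under [in RHS]eq_fun do rewrite mulE.
rewrite !cintegralD ?cintegralZ ?transfer_indic//;
  try (apply: cintegrableZ).
all: by [exact: cintegrable_cindicM|exact: cintegrable_cindic_compM].
Qed.

(** Testing against the indicator of [A], this is duality for [f] multiplied by
    that indicator. *)
Lemma transferM f h : cmeasurable f -> cintegrable mu h ->
  cintegrable mu (fun x => f (sigma x) * h x) ->
  transfer (fun x => f (sigma x) * h x) = (fun x => f x * transfer h x) %[ae mu].
Proof.
move=> mf ih ifh; apply: transfer_unique => [//||A mA].
  exact: (transfer_duality mf ih ifh).1.
under eq_fun do rewrite mulrA; under [in RHS]eq_fun do rewrite mulrA.
apply: (@transfer_duality (fun x => cindic A x * f x) h _ ih _).2.
- exact/cmeasurableM/mf/cmeasurable_cindic.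
- by under eq_fun do rewrite -mulrA; exact: cintegrable_cindic_compM.
Qed.

Lemma transferJ h : cintegrable mu h ->
  transfer (fun x => conjc (h x)) = (fun x => conjc (transfer h x)) %[ae mu].
Proof.
move=> ih; apply: transfer_unique => [||A mA].
- exact: cintegrableJ.
- exact/cintegrableJ/cintegrable_transfer.
have J (r : R) (z : R[i]) : r%:C%C * conjc z = conjc (r%:C%C * z).
  by rewrite rmorphM /= oppr0.
under eq_fun do rewrite J; under [in RHS]eq_fun do rewrite J.
rewrite !cintegralJ ?transfer_indic//.
- exact/cintegrable_cindicM/cintegrable_transfer.
- exact: cintegrable_cindic_compM.
Qed.

End complex_transfer.

(** * Weighted composition operators on L^2 *)

Section weighted_composition_operator.
Context (R : realType) d (X : measurableType d) (mu : probability X R).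
Variable sigma : {mfun X >-> X}.
Hypothesis sigma_qi : quasi_invariant mu sigma.
Variable k : X -> R[i].
Hypothesis mk : cmeasurable k.
Implicit Types f g h : X -> R[i].

Definition wcomp f : X -> R[i] := fun x => k x * f (sigma x).

Definition wcomp_adj g : X -> R[i] :=
  transfer mu sigma (fun x => conjc (k x) * g x).

Lemma cmeasurable_wcomp f : cmeasurable f -> cmeasurable (wcomp f).
Proof. by move=> mf; apply: cmeasurableM => //; exact: cmeasurable_comp. Qed.

Lemma wcomp_ae f g : f = g %[ae mu] -> wcomp f = wcomp g %[ae mu].
Proof.
move=> fg; have : \forall x \ae mu, f (sigma x) = g (sigma x).
  apply: (@ae_comp _ _ _ _ _ sigma_qi (fun x => f x = g x)).
  by apply: filterS fg => x; exact.
by apply: filterS => x fgx _; rewrite /wcomp fgx.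
Qed.

Lemma weight_sqrE x : conjc (k x) * k x = (normc (k x) ^+ 2)%:C%C.
Proof. by rewrite mulrC mulc_conj. Qed.

Lemma L2_weight : cintegrable mu (fun x => conjc (k x) * k x) -> L2 mu k.
Proof.
move=> [ik _]; apply/L2_integrable; split=> //.
by move: ik; under eq_fun do rewrite weight_sqrE.
Qed.

(** By duality for the nonnegative function [|f|^2],
    [\int |k|^2 |f \o sigma|^2 = \int |f|^2 transfer (|k|^2) = \int |f|^2], where
    the integrals may be infinite. Allowing this is essential: the lemma is used
    to prove that [f] is square integrable when its image is. *)
Lemma L2norm_wcomp f : cintegrable mu (fun x => conjc (k x) * k x) ->
  transfer mu sigma (fun x => conjc (k x) * k x) = cst 1 %[ae mu] ->
  cmeasurable f -> L2norm mu (wcomp f) = L2norm mu f.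
Proof.
move=> /L2_weight/L2_integrable[_ ik] k1 mf; rewrite !L2normE; congr (_ `^ _)%E.
have k0 x : 0 <= normc (k x) ^+ 2 by exact: sqr_ge0.
have [p [kp _ mp pE]] := ge0_density_duality sigma_qi ik k0.
have p1 : p = cst 1 %[ae mu].
  apply: filterS2 k1 kp => x /(_ Logic.I)/(congr1 (@complex.Re R)) /= k1x kpx _.
  rewrite -kpx// -k1x; congr (pushforward_density _ _ _ _).
  by apply/funext => y; rewrite weight_sqrE.
have mf2 := measurable_sqr_normc mf.
transitivity (\int[mu]_x (normc (f (sigma x)) ^+ 2 * normc (k x) ^+ 2)%:E)%E.
  by apply: eq_integral => x _; rewrite normcM exprMn mulrC.
rewrite (pE (fun x => normc (f x) ^+ 2))//; last by move=> x; exact: sqr_ge0.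
apply: ae_eq_integral => //.
- exact/measurable_EFinP/measurable_funM.
- exact/measurable_EFinP.
- by apply: filterS p1 => x /[apply] ->; rewrite mulr1.
Qed.

Lemma wcomp_isometry : cintegrable mu (fun x => conjc (k x) * k x) ->
  transfer mu sigma (fun x => conjc (k x) * k x) = cst 1 %[ae mu] ->
  L2_isometry mu wcomp.
Proof.
move=> ik k1.
have norm_wcomp f : L2 mu f -> L2norm mu (wcomp f) = L2norm mu f.
  by move=> [mf _]; exact: L2norm_wcomp.
split=> //; split.
- move=> f f2; split; last by rewrite norm_wcomp//; exact: f2.2.
  exact/cmeasurable_wcomp/f2.1.
- by move=> f g _ _; exact: wcomp_ae.
- by move=> c f g _ _; apply: aeW => x _; rewrite /wcomp; ring.
Qed.

(** The weight is the image of the constant function [1]. *)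
Lemma isometry_L2_weight : L2_isometry mu wcomp -> L2 mu k.
Proof.
move=> [[TL2 _ _] _].
have -> : k = wcomp (fun=> 1) by apply/funext => x; rewrite /wcomp mulr1.
by apply: TL2; exact: L2_cst.
Qed.

(** Converse to [wcomp_isometry]: equality of the norms of the indicator of [A] and
    of its image says that [|k|^2] has integral [mu A] over [sigma^-1 A]. *)
Lemma isometry_transfer1 : L2_isometry mu wcomp ->
  transfer mu sigma (fun x => conjc (k x) * k x) = cst 1 %[ae mu].
Proof.
move=> Tiso; have k2 := isometry_L2_weight Tiso.
have ikk : cintegrable mu (fun x => conjc (k x) * k x).
  exact: cintegrable_L2M (L2J k2) k2.
apply: transfer_unique => //.
  by split=> /=; exact: finite_measure_integrable_cst.
move=> A mA.
have sqr_indic x : normc (cindic R A x) ^+ 2 = \1_A x :> R.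
  by rewrite normc_real indicE; case: (_ \in _); rewrite ?expr1n ?expr0n.
have := congr1 (fun r => r `^ 2)%E (Tiso.2 _ (L2_cindic mu mA)).
rewrite !L2norm_pow => AE; rewrite /cintegral; congr Complex.
- transitivity (\int[mu]_x (normc (wcomp (cindic R A) x) ^+ 2)).
    apply: eq_Rintegral => x _; rewrite weight_sqrE normcM exprMn sqr_indic /=.
    by rewrite mul0r subr0 mulrC.
  rewrite /Rintegral AE; congr fine; apply: eq_integral => x _.
  by rewrite sqr_indic /= mul0r subr0 mulr1.
- apply: eq_Rintegral => x _; rewrite weight_sqrE.
  by rewrite /cindic !cImM /= !(mul0r, mulr0, addr0).
Qed.

(** [<T f, g> = \int (f \o sigma) (k conj g) = \int f transfer (k conj g)], and the
    transfer commutes with conjugation. *)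
Lemma wcomp_adjointE f g : L2 mu k -> L2 mu f -> L2 mu g -> L2 mu (wcomp f) ->
  L2inner mu (wcomp f) g = L2inner mu f (wcomp_adj g).
Proof.
move=> k2 f2 g2 Tf2.
have ikg : cintegrable mu (fun x => conjc (k x) * g x).
  exact: cintegrable_L2M (L2J k2) g2.
have ikg' : cintegrable mu (fun x => k x * conjc (g x)).
  exact: cintegrable_L2M k2 (L2J g2).
have E : (fun x => wcomp f x * conjc (g x)) =
    (fun x => f (sigma x) * (k x * conjc (g x))).
  by apply/funext => x; rewrite /wcomp; ring.
have iT : cintegrable mu (fun x => f (sigma x) * (k x * conjc (g x))).
  by rewrite -E; exact: cintegrable_L2M Tf2 (L2J g2).
have [itr dual] := transfer_duality sigma_qi f2.1 ikg' iT.
rewrite /L2inner E dual; apply: eq_cintegral_ae.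
- exact: cintegrable_cmeasurable itr.
- apply: cmeasurableM; [exact: f2.1|apply: cmeasurableJ].
  exact: cmeasurable_transfer.
have := transferJ sigma_qi ikg; apply: filterS => x /[apply] <-.
congr (_ * transfer _ _ _ _); apply/funext => y.
by rewrite rmorphM /= conjcK.
Qed.

(** Any adjoint agrees with [wcomp_adj]: pairing with the indicator of [A] shows
    that [S g] has the integrals over sets which characterize the transfer. *)
Lemma wcomp_adj_unique S g : L2_isometry mu wcomp -> L2_adjoint mu wcomp S ->
  L2 mu g -> wcomp_adj g = S g %[ae mu].
Proof.
move=> Tiso [[SL2 _ _] TS] g2; have [[TL2 _ _] _] := Tiso; have k2 := isometry_L2_weight Tiso.
have ikg : cintegrable mu (fun x => conjc (k x) * g x).
  exact: cintegrable_L2M (L2J k2) g2.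
apply: transfer_unique => //.
  by have := cintegrable_L2M (L2_cst mu 1) (SL2 _ g2); under eq_fun do rewrite mul1r.
move=> A mA; have A2 := L2_cindic mu mA.
have := congr1 (@conjc R) (TS _ _ A2 g2); rewrite /L2inner.
rewrite -!cintegralJ; last 2 first.
- exact: cintegrable_L2M A2 (L2J (SL2 _ g2)).
- exact: cintegrable_L2M (TL2 _ A2) (L2J g2).
have conj_cindic x : conjc (cindic R A x) = cindic R A x by rewrite /= oppr0.
have -> : (fun x => conjc (wcomp (cindic R A) x * conjc (g x))) =
    (fun x => cindic R A (sigma x) * (conjc (k x) * g x)).
  apply/funext => x; rewrite !rmorphM /= conjcK -/(conjc _) oppr0.
  by rewrite mulrA; congr (_ * _); rewrite mulrC.
move=> ->; congr (cintegral _ _); apply/funext => x.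
by rewrite rmorphM /= conjcK oppr0.
Qed.

End weighted_composition_operator.

(** * Norm convergence modulo null sets *)

Section unconditional_sums.
Context (R : realType) d (X : measurableType d) (mu : probability X R).

Lemma L2norm0 : L2norm mu (cst 0) = 0%E.
Proof.
rewrite L2normE; under eq_integral do rewrite normc0 expr0n.
by rewrite integral0 poweR0r// invr_neq0.
Qed.

Lemma L2norm_eq0_ae (f : X -> R[i]) :
  cmeasurable f -> L2norm mu f = 0%E -> f = cst 0 %[ae mu].
Proof.
move=> mf f0; have : (fun x => (normc (f x))%:E) = \0%E %[ae mu].
  apply: (@Lnorm_eq0_eq0 _ _ _ _ _ 2%:E) => //.
  exact/measurable_EFinP/measurable_normc.
by apply: filterS => x /[apply] -[] /eq0_normc.
Qed.

Lemma L2_sums_to_ae (I : countType) (u v : I -> X -> R[i]) (f : X -> R[i]) :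
  L2 mu f -> (forall i, cmeasurable (v i)) ->
  (forall i, u i = v i %[ae mu]) -> L2_sums_to mu u f -> L2_sums_to mu v f.
Proof.
move=> f2 mv uv [u2 cvg_u].
have mu_ i := (u2 i).1.
have msum (w : I -> X -> R[i]) (s : seq I) : (forall i, cmeasurable (w i)) ->
    cmeasurable (fun x => \sum_(i <- s) w i x - f x).
  move=> mw; apply: cmeasurableD; last first.
    under eq_fun do rewrite -mulN1r.
    exact: cmeasurableM (cmeasurable_cst _ _) f2.1.
  elim: s => [|i s IH].
    by under eq_fun do rewrite big_nil; exact: cmeasurable_cst.
  by under eq_fun do rewrite big_cons; exact: cmeasurableD.
have sum_ae (s : seq I) :
    \forall x \ae mu, \sum_(i <- s) u i x = \sum_(i <- s) v i x.
  elim: s => [|i s IH]; first by apply: aeW => x; rewrite !big_nil.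
  apply: filterS2 (uv i) IH => x /(_ Logic.I) uvx IHx.
  by rewrite !big_cons uvx IHx.
split=> [i|].
  split=> //; rewrite -(eq_L2norm_ae (mu_ i) (mv i) (uv i)).
  exact: (u2 i).2.
rewrite (_ : (fun A => L2norm mu (fun x => \sum_(i <- enum_fset A) v i x - f x)) =
    (fun A => L2norm mu (fun x => \sum_(i <- enum_fset A) u i x - f x)))//.
apply/esym/funext => A.
apply: eq_L2norm_ae; [exact: msum|exact: msum|].
by apply: filterS (sum_ae (enum_fset A)) => x -> _.
Qed.

End unconditional_sums.

(** * Families of weighted composition operators *)

Section cuntz_family.
Context (R : realType) d (X : measurableType d) (mu : probability X R).
Variable sigma : {mfun X >-> X}.
Hypothesis sigma_qi : quasi_invariant mu sigma.
Variables (I : countType) (k : I -> X -> R[i]).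
Hypothesis mk : forall i, cmeasurable (k i).

Local Notation T i := (wcomp sigma (k i)).
Local Notation S i := (wcomp_adj mu sigma (k i)).

(** The module property of the transfer turns [T i^* T j] into multiplication by
    the function [transfer (conj (k i) k j)]. *)
Lemma wcomp_adj_wcomp i j (u : X -> R[i]) : L2 mu (k i) -> L2 mu (k j) ->
  L2 mu (T j u) -> cmeasurable u ->
  S i (T j u) =
  (fun x => u x * transfer mu sigma (fun y => conjc (k i y) * k j y) x) %[ae mu].
Proof.
move=> ki2 kj2 Tu2 mu_.
rewrite /wcomp_adj (_ : (fun x => _) =
    (fun x => u (sigma x) * (conjc (k i x) * k j x))); last first.
  by apply/funext => x; rewrite /wcomp; ring.
apply: transferM => //; first exact: cintegrable_L2M (L2J ki2) kj2.
have := cintegrable_L2M (L2J ki2) Tu2.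
by congr cintegrable; apply/funext => x; rewrite /wcomp; ring.
Qed.

(** The theorem in terms of the weights [k i]; the first condition is
    [T j^* T i = delta_ij], the second is [\sum_i T i T i^* = 1]. *)
Theorem cuntz_wcompP :
  cuntz_representation mu (fun i => T i) <->
  (forall i j, cintegrable mu (fun x => conjc (k j x) * k i x) /\
     transfer mu sigma (fun x => conjc (k j x) * k i x) =
       cst (i == j)%:R %[ae mu]) /\
  (forall f, L2 mu f ->
     (forall i, cintegrable mu (fun x => conjc (k i x) * f x)) /\
     L2_sums_to mu (fun i => T i (S i f)) f).
Proof.
split.
- move=> [Tiso [Tadj [adjT orthT sumT]]].
  have k2 i := isometry_L2_weight (Tiso i).
  have adjE i g : L2 mu g -> S i g = Tadj i g %[ae mu].
    by move=> g2; apply: wcomp_adj_unique => //.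
  have ikk i j : cintegrable mu (fun x => conjc (k j x) * k i x).
    exact: cintegrable_L2M (L2J (k2 j)) (k2 i).
  have T1 i : T i (fun=> 1) = k i by apply/funext => x; rewrite /wcomp mulr1.
  split=> [i j|f f2].
    split; first exact: ikk.
    have [<-{j}|ij] := eqVneq i j; first exact: isometry_transfer1.
    (* Orthogonality applied to [k i = T i 1] makes [T j (T j^* p)] vanish for
       [p = T i (T i^* (k i))], which equals [k i] because [T i^* T i 1 = 1].
       As [T j] is isometric, [T j^* (k i) = transfer (conj (k j) k i)] is zero. *)
    have [[TadjL2 Tadj_ae _] _] := adjT j; have [[_ T_ae _] Tnorm] := Tiso j.
    have [[TadjiL2 _ _] _] := adjT i; have [[TiL2 _ _] _] := Tiso i.
    pose p := T i (Tadj i (k i)).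
    have p2 : L2 mu p by exact/TiL2/TadjiL2.
    have pk : p = T i (fun=> 1) %[ae mu].
      apply: wcomp_ae => //; have := isometry_transfer1 sigma_qi (Tiso i).
      by apply: filterS2 (adjE i (k i) (k2 i)) => x Ex E1x xT; rewrite -Ex//; exact: E1x.
    rewrite T1 in pk.
    have q2 : L2 mu (Tadj j p) by exact: TadjL2.
    have q0 : Tadj j p = cst 0 %[ae mu].
      apply: L2norm_eq0_ae; first exact: q2.1.
      rewrite -Tnorm// -(L2norm0 mu); apply: eq_L2norm_ae.
      - exact/cmeasurable_wcomp/q2.1.
      - exact: cmeasurable_cst.
      - by apply: orthT => //; rewrite eq_sym.
    have qk := Tadj_ae _ _ p2 (k2 i) pk.
    apply: filterS3 q0 qk (adjE j _ (k2 i)) => x q0x qkx Ex xT.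
    by rewrite -[LHS]/(S j (k i) x) Ex// -qkx// q0x.
  split=> [i|]; first exact: cintegrable_L2M (L2J (k2 i)) f2.
  apply: L2_sums_to_ae (sumT f f2) => // i.
    exact/cmeasurable_wcomp/cmeasurable_transfer.
  by apply: wcomp_ae => //; have := adjE i f f2; apply: filterS => x /[apply] ->.
- move=> [ortho complete].
  have k2 i : L2 mu (k i) by apply: L2_weight => //; exact: (ortho i i).1.
  have Tiso i : L2_isometry mu (T i).
    have [ik k1] := ortho i i; apply: wcomp_isometry => //.
    by move: k1; rewrite eqxx.
  have SL2 i f : L2 mu f -> L2 mu (S i f).
    move=> f2; have [ik k1] := ortho i i; rewrite eqxx in k1.
    have mS : cmeasurable (S i f) by exact: cmeasurable_transfer.
    (* The image of [S i f] under [T i] is a term of the series in the second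
       condition, hence square integrable. *)
    split=> //; rewrite -(L2norm_wcomp sigma_qi (mk i) ik k1 mS).
    exact: ((complete f f2).2.1 i).2.
  have ikf i f : L2 mu f -> cintegrable mu (fun x => conjc (k i x) * f x).
    exact: cintegrable_L2M (L2J (k2 i)).
  have TL2 i f : L2 mu f -> L2 mu (T i f).
    by have [[TL2 _ _] _] := Tiso i; exact: TL2.
  split=> //; exists (fun i => S i); split=> [i|i j ij f f2|f f2].
  + split; last by move=> f g f2 g2; apply: wcomp_adjointE => //; exact: TL2.
    split; first exact: SL2.
      move=> f g f2 g2 fg; apply: transfer_ae; [by []|exact: ikf|exact: ikf|].
      by apply: filterS fg => x /[apply] ->.
    move=> c f g f2 g2.
    have E : (fun x => conjc (k i x) * (c * f x + g x)) =
        (fun x => c * (conjc (k i x) * f x) + conjc (k i x) * g x).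
      by apply/funext => x; ring.
    by rewrite /wcomp_adj E; apply: transfer_linear => //; exact: ikf.
  + have S2 := SL2 j f f2.
    have := wcomp_adj_wcomp (k2 i) (k2 j) (TL2 j _ S2) S2.1.
    have [_] := ortho j i; rewrite eq_sym (negbTE ij) => k0 SS.
    have STS0 : S i (T j (S j f)) = cst 0 %[ae mu].
      by apply: filterS2 k0 SS => x k0x SSx xT; rewrite SSx// k0x//= mulr0.
    have := wcomp_ae sigma_qi (k i) STS0; apply: filterS => x /[apply] ->.
    by rewrite /wcomp mulr0.
  + exact: (complete f f2).2.
Qed.

End cuntz_family.

Theorem theorem1p1 (R : realType) (d : measure_display) (X : measurableType d)
    (mu : probability X R) (sigma : {mfun X >-> X}) (phi : X -> R)
    (I : countType) (m : I -> X -> R[i])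
    (X_standard : standard_borel R X)
    (mu_nonatomic : nonatomic mu)
    (sigma_onto : forall y : X, exists x : X, sigma x = y)
    (mu_quasi_invariant : quasi_invariant mu sigma)
    (phi_markovian : markovian mu sigma phi)
    (phi_positive : \forall x \ae mu, 0 < phi x)
    (m_measurable : forall i : I, cmeasurable (m i)) :
  cuntz_representation mu (fun i : I => T_op sigma phi (m i))
  <->
  (forall i j : I,
     let g := fun x => sqrt_weight phi x * conjc (m j x) * m i x in
     Sadj_defined mu phi g /\
     Sadj mu sigma phi g = cst (i == j)%:R %[ae mu])
  /\
  (forall f : X -> R[i], L2 mu f ->
     (forall i : I, Sadj_defined mu phi (fun x => conjc (m i x) * f x)) /\
     L2_sums_to mu
       (fun (i : I) x =>
          m i x * Ephi mu sigma phi (fun y => conjc (m i y) * f y) x) f).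
Proof.
have msw : cmeasurable (sqrt_weight phi : X -> R[i]).
  exact/cmeasurable_real/(measurableT_comp (@measurable_sqrt R))/phi_markovian.1.
(* [sqrt phi] is real, so conjugating [k i] only conjugates [m i]; what remains is
   to match the positions of the factors [sqrt phi]. *)
pose k i x := m i x * sqrt_weight phi x.
have mk i : cmeasurable (k i) by exact: cmeasurableM.
have J i x : conjc (k i x) = conjc (m i x) * sqrt_weight phi x.
  by rewrite rmorphM /= oppr0.
have weightE i j : (fun x => sqrt_weight phi x *
    (sqrt_weight phi x * conjc (m j x) * m i x)) = (fun x => conjc (k j x) * k i x).
  by apply/funext => x; rewrite J /k; ring.
have SadjE i j : Sadj mu sigma phi
      (fun x => sqrt_weight phi x * conjc (m j x) * m i x) =
    transfer mu sigma (fun x => conjc (k j x) * k i x).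
  by rewrite -weightE; congr (transfer mu sigma _); apply/funext => x; rewrite mulrC.
have adj_weightE i f : (fun x => sqrt_weight phi x * (conjc (m i x) * f x)) =
    (fun x => conjc (k i x) * f x).
  by apply/funext => x; rewrite J; ring.
have EphiE i f : (fun x => m i x *
      Ephi mu sigma phi (fun y => conjc (m i y) * f y) x) =
    wcomp sigma (k i) (wcomp_adj mu sigma (k i) f).
  apply/funext => x; rewrite /wcomp /wcomp_adj -adj_weightE /Ephi /S_op mulrA.
  congr (_ * transfer mu sigma _ _); apply/funext => y.
  by rewrite mulrC.
have [fwd bwd] := cuntz_wcompP mu_quasi_invariant mk.
split.
- move=> /fwd[ortho complete]; split=> [i j|f f2].
    have [ikk dkk] := ortho i j; rewrite /= SadjE; split=> //; split.
      by apply: cmeasurableM => //; apply: cmeasurableM => //; exact: cmeasurableJ.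
    by rewrite weightE.
  have [ikf sumf] := complete f f2; split=> [i|].
    split; last by rewrite adj_weightE.
    by apply: cmeasurableM; [exact: cmeasurableJ|exact: f2.1].
  by under [X in L2_sums_to _ X _]eq_fun do rewrite EphiE.
- move=> [ortho complete]; apply: bwd; split=> [i j|f f2].
    by have [[_ +]] := ortho i j; rewrite /= SadjE weightE.
  have [ikf sumf] := complete f f2; split=> [i|].
    by have [_ +] := ikf i; rewrite adj_weightE.
  by move: sumf; under [X in L2_sums_to _ X _]eq_fun do rewrite EphiE.
Qed.
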